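(* Let $R$ be a ring, let $\Sigma$ be the set of non zero divisors of $R$, and let $S\subseteq\Sigma$ be a multiplicative subset satisfying the right Ore condition such that $Q=RS^{-1}$ is right $\aleph_0$-noetherian. Then the cotorsion pair $(\mathcal{P}_1,\mathcal{P}_1^{\perp})$ of right $R$-modules is of countable type.
   Context: Rings are associative with unit. A ring is right $\aleph_0$-noetherian if all its right ideals are at most $\aleph_0$-generated. $\mathcal{P}_1$ is the class of right $R$-modules of projective dimension at most $1$. For a class $\mathcal{C}$ of right $R$-modules, $\mathcal{C}^{\perp}=\{X : \mathrm{Ext}_R^i(C,X)=0 \text{ for all } C\in\mathcal{C},\ i\ge 1\}$ and ${}^{\perp}\mathcal{C}=\{X : \mathrm{Ext}_R^i(X,C)=0 \text{ for all } C\in\mathcal{C},\ i\ge 1\}$. A hereditary cotorsion pair is a pair $(\mathcal{A},\mathcal{B})$ with $\mathcal{A}={}^{\perp}\mathcal{B}$ and $\mathcal{B}=\mathcal{A}^{\perp}$; $(\mathcal{P}_1,\mathcal{P}_1^{\perp})$ is one. $\mathrm{mod}_{\aleph_0}\text{-}R$ is the class of right $R$-modules having a projective resolution consisting of countably generated projective modules. A hereditary cotorsion pair $(\mathcal{A},\mathcal{B})$ is of countable type if there is a class $\mathcal{S}\subseteq\mathrm{mod}_{\aleph_0}\text{-}R$ with $\mathcal{S}^{\perp}=\mathcal{B}$. *)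

(* Defs.v *)
From HB Require Import structures.
From mathcomp Require Import all_boot all_order all_algebra.
From mathcomp Require Import boolp classical_sets functions cardinality.

Set Implicit Arguments.
Unset Strict Implicit.
Unset Printing Implicit Defensive.

Import GRing.Theory.
Local Open Scope ring_scope.
Local Open Scope classical_set_scope.

(* Right R-modules are objects of [lmodType R^c], where R^c is the converse    *)
(* ring; right ideals of R are then the submodules of R^c^o. Everything that   *)
(* does not depend on the side is stated for [lmodType R], R arbitrary.        *)
(* [pzRingType] is used throughout, so that the zero ring is not excluded.     *)

Definition is_submodule (R : pzRingType) (M : lmodType R) (N : set M) : Prop :=
  N 0 /\ (forall (a : R) (u v : M), N u -> N v -> N (a *: u + v)).

Definition submodule_span (R : pzRingType) (M : lmodType R) (G : set M) :
    set M :=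
  smallest (@is_submodule R M) G.

(* [countable] includes the finite case. *)
Definition countably_generated (R : pzRingType) (M : lmodType R) (N : set M) :
    Prop :=
  exists2 G : set M, countable G & submodule_span G = N.

Definition right_ideal (R : pzRingType) (I : set R) : Prop :=
  @is_submodule R^c R^c^o I.

Definition right_aleph0_noetherian (R : pzRingType) : Prop :=
  forall I : set R, right_ideal I -> @countably_generated R^c R^c^o I.

Definition non_zero_divisors (R : pzRingType) : set R :=
  [set x | GRing.lreg x /\ GRing.rreg x].

Definition multiplicative_subset (R : pzRingType) (S : set R) : Prop :=
  S 1 /\ (forall s t : R, S s -> S t -> S (s * t)).

Definition right_Ore (R : pzRingType) (S : set R) : Prop :=
  forall (r s : R), S s ->
    exists (r' s' : R), S s' /\ r * s' = s * r'.

(* [phi : R -> Q] exhibits Q as the right ring of fractions R S^-1: phi is     *)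
(* S-inverting, every element of Q has the form phi(r) phi(s)^-1, and          *)
(* phi(r) = 0 exactly when r is killed on the right by an element of S. This   *)
(* determines (Q, phi) up to a unique isomorphism under R.                     *)
Definition is_right_ring_of_fractions (R : pzRingType) (S : set R)
    (Q : pzRingType) (phi : {rmorphism R -> Q}) : Prop :=
  [/\ (forall s : R, S s -> exists t : Q, phi s * t = 1 /\ t * phi s = 1),
      (forall q : Q, exists (r s : R) (t : Q),
         [/\ S s, phi s * t = 1, t * phi s = 1 & q = phi r * t]) &
      (forall r : R, phi r = 0 <-> exists2 s : R, S s & r * s = 0)].

Definition projective (R : pzRingType) (P : lmodType R) : Prop :=
  forall (A B : lmodType R) (g : {linear A -> B}) (f : {linear P -> B}),
    (forall b : B, exists a : A, g a = b) ->
    exists h : {linear P -> A}, forall x : P, g (h x) = f x.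

(*   ... -> P_2 --d_1--> P_1 --d_0--> P_0 --aug--> M -> 0   exact              *)
Record projective_resolution (R : pzRingType) (M : lmodType R) :=
  ProjectiveResolution {
    res_obj :> nat -> lmodType R;
    res_d : forall n : nat, {linear res_obj n.+1 -> res_obj n};
    res_aug : {linear res_obj 0%N -> M};
    res_projective : forall n : nat, projective (res_obj n);
    res_aug_surj : forall m : M, exists x, res_aug x = m;
    res_exact0 : forall x, res_aug x = 0 <-> exists y, res_d 0 y = x;
    res_exactS : forall n x, res_d n x = 0 <-> exists y, res_d n.+1 y = x
  }.

(* The i-th cohomology of the complex Hom(P, X) is zero: every cocycle is a    *)
(* coboundary.                                                                 *)
Definition Hom_cohomology_vanishes (R : pzRingType) (M X : lmodType R)
    (P : projective_resolution M) (i : nat) : Prop :=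
  match i with
  | 0%N => forall f : {linear P 0%N -> X},
      (forall y, f (res_d P 0 y) = 0) -> forall x, f x = 0
  | n.+1 => forall f : {linear P n.+1 -> X},
      (forall y, f (res_d P n.+1 y) = 0) ->
      exists g : {linear P n -> X}, forall x, f x = g (res_d P n x)
  end.

(* Ext_R^i(M, X) = 0. The cohomology does not depend on the resolution. *)
Definition Ext_vanishes (R : pzRingType) (i : nat) (M X : lmodType R) : Prop :=
  forall P : projective_resolution M, Hom_cohomology_vanishes X P i.

Definition module_class (R : pzRingType) := lmodType R -> Prop.

Definition right_perp (R : pzRingType) (C : module_class R) : module_class R :=
  fun X => forall M : lmodType R, C M ->
    forall i : nat, (1 <= i)%N -> Ext_vanishes i M X.

Definition left_perp (R : pzRingType) (C : module_class R) : module_class R :=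
  fun X => forall M : lmodType R, C M ->
    forall i : nat, (1 <= i)%N -> Ext_vanishes i X M.

Definition same_class (R : pzRingType) (C D : module_class R) : Prop :=
  forall M : lmodType R, C M <-> D M.

Definition hereditary_cotorsion_pair (R : pzRingType) (A B : module_class R) :
    Prop :=
  same_class A (left_perp B) /\ same_class B (right_perp A).

(* Projective dimension at most n: some projective resolution is zero above    *)
(* degree n.                                                                   *)
Definition pdim_le (R : pzRingType) (n : nat) : module_class R :=
  fun M => exists P : projective_resolution M,
    forall k : nat, (n < k)%N -> forall x : P k, x = 0.

Definition mod_aleph0 (R : pzRingType) : module_class R :=
  fun M => exists P : projective_resolution M,
    forall k : nat, countably_generated [set: P k].

Definition of_countable_type (R : pzRingType) (A B : module_class R) : Prop :=
  hereditary_cotorsion_pair A B /\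
  exists S : module_class R,
    (forall M : lmodType R, S M -> mod_aleph0 M) /\
    same_class (right_perp S) B.

Arguments pdim_le {R} n _.

(* Main.v *)
Require Import Defs.
From HB Require Import structures.
From mathcomp Require Import all_boot all_order all_algebra.
From mathcomp Require Import boolp classical_sets functions cardinality.

(* Let M have projective dimension at most 1. Eilenberg's swindle presents M
   as the cokernel of an injective map u : R^(A) -> R^(B) of free modules.
   Since Q is flat over R and aleph_0-noetherian, for a countable set C of
   basis elements of R^(B), the submodule u^-1(R^(C)) is, up to denominators,
   countably generated, hence supported on countably many elements of A,
   because denominators are regular. Closing off, M is a union of a
   continuous chain whose successive quotients are cokernels of injective
   maps between free modules of countable rank. Hence a module X that extends
   all homomorphisms along such countable maps is in the class P_1^perp
   (Eklof's lemma, done here with Zorn's lemma), which gives countable type.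

   Conversely let M be in perp(P_1^perp) and K the kernel of a surjection
   from a free module F to M. Formally adjoining to K the solutions of all
   countable systems, by an inductive type of systems whose right-hand sides
   may involve the formal solutions of earlier ones, embeds K in a module X
   of P_1^perp, presented as (K + free)/(free). The inclusion K -> X extends
   to F, and lifting the extension to K + free shows that K is a retract of a
   free module, so M has projective dimension at most 1. *)

Set Implicit Arguments.
Unset Strict Implicit.
Unset Printing Implicit Defensive.

Import GRing.Theory.
Local Open Scope ring_scope.
Local Open Scope classical_set_scope.
Local Open Scope quotient_scope.

(** * Submodules, quotients and free modules *)

Definition lin (T : pzRingType) (A B : lmodType T) (f : A -> B)
    (f_lin : linear f) : {linear A -> B} :=
  HB.pack f (GRing.isLinear.Build T A B *:%R f f_lin).

Section Submodule.
Variables (T : pzRingType) (M : lmodType T) (N : set M).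

(** The predicate carries the proof that [N] is a submodule so that the closure instance below can
    be inferred from the term [submod_mem HN]. *)
Definition submod_mem of is_submodule N : {pred M} := fun x => `[< N x >].

Hypothesis HN : is_submodule N.

Lemma submod_mem_closed : submod_closed (submod_mem HN).
Proof.
case: (HN) => N0 Nlin; split; first exact/asboolP.
by move=> a u v /asboolP Nu /asboolP Nv; apply/asboolP; apply: Nlin.
Qed.

HB.instance Definition _ :=
  GRing.isSubmodClosed.Build T M (submod_mem HN) submod_mem_closed.

Definition submod := {x : M | submod_mem HN x}.
HB.instance Definition _ := SubChoice.on submod.
HB.instance Definition _ := [SubChoice_isSubLmodule of submod by <:].

Lemma submodP (x : submod) : N (val x).
Proof. exact/asboolP/(valP x). Qed.

Definition Submod (x : M) (Nx : N x) : submod := exist _ x (asboolT Nx).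

Definition quotmod := Quotient.quot (submod_mem HN).
HB.instance Definition _ := GRing.Zmodule.on quotmod.

Definition quotmod_proj (x : M) : quotmod := \pi_(Quotient.quot (submod_mem HN)) x.

Lemma quotmod_proj_surj (q : quotmod) : exists x, quotmod_proj x = q.
Proof. by exists (repr q); exact: reprK. Qed.

Lemma quotmod_proj_eq (x y : M) : quotmod_proj x = quotmod_proj y <-> N (x - y).
Proof.
split=> [/eqP|Nxy]; first by rewrite -Quotient.idealrBE => /asboolP.
by apply/eqP; rewrite -Quotient.idealrBE; exact/asboolP.
Qed.

Definition quotmod_scale (a : T) (q : quotmod) : quotmod :=
  quotmod_proj (a *: repr q).

Lemma quotmod_scale_proj (a : T) (x : M) :
  quotmod_scale a (quotmod_proj x) = quotmod_proj (a *: x).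
Proof.
apply/quotmod_proj_eq; rewrite -scalerBr -[_ *: _]addr0.
apply: (proj2 HN); last exact: (proj1 HN); apply/quotmod_proj_eq.
exact: reprK.
Qed.

Let projD : {morph quotmod_proj : x y / x + y}.
Proof. by move=> x y; rewrite /quotmod_proj raddfD. Qed.

Let quotmod_scalerA a b q :
  quotmod_scale a (quotmod_scale b q) = quotmod_scale (a * b) q.
Proof.
by case: (quotmod_proj_surj q) => x <-; rewrite !quotmod_scale_proj scalerA.
Qed.

Let quotmod_scale1r : left_id 1 quotmod_scale.
Proof.
by move=> q; case: (quotmod_proj_surj q) => x <-; rewrite quotmod_scale_proj scale1r.
Qed.

Let quotmod_scalerDr : right_distributive quotmod_scale +%R.
Proof.
move=> a q r; case: (quotmod_proj_surj q) => x <-.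
case: (quotmod_proj_surj r) => y <-.
by rewrite -projD !quotmod_scale_proj scalerDr projD.
Qed.

Let quotmod_scalerDl q : {morph quotmod_scale^~ q : a b / a + b}.
Proof.
move=> a b; case: (quotmod_proj_surj q) => x <-.
by rewrite !quotmod_scale_proj scalerDl projD.
Qed.

HB.instance Definition _ := GRing.Zmodule_isLmodule.Build T quotmod
  quotmod_scalerA quotmod_scale1r quotmod_scalerDr quotmod_scalerDl.

Lemma quotmod_proj_is_linear : linear quotmod_proj.
Proof.
by move=> a x y; rewrite projD -quotmod_scale_proj.
Qed.

HB.instance Definition _ :=
  GRing.isLinear.Build T M quotmod *:%R quotmod_proj quotmod_proj_is_linear.

Lemma quotmod_proj_eq0 (x : M) : quotmod_proj x = 0 <-> N x.
Proof. by rewrite -(raddf0 quotmod_proj) quotmod_proj_eq subr0. Qed.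

End Submodule.

Section FreeModule.
Variables (T : pzRingType) (I : choiceType).

Definition finitely_supported : set (I -> T^o) :=
  [set f | exists s : seq I, forall i, f i != 0 -> i \in s].

Lemma finitely_supported_submodule : is_submodule finitely_supported.
Proof.
split; first by exists [::] => i; rewrite eqxx.
move=> a f g [s fs] [t gt]; exists (s ++ t) => i; rewrite mem_cat.
have [fi0|/fs ->//] := eqVneq (f i) 0; have [gi0|/gt ->] := eqVneq (g i) 0.
  by rewrite !fctE fi0 gi0 scaler0 addr0 eqxx.
by rewrite orbT.
Qed.

Definition freemod : lmodType T := submod finitely_supported_submodule.

Definition coef (i : I) (x : freemod) : T^o :=
  val (x : submod finitely_supported_submodule) i.

Lemma coef_is_linear i : linear (coef i).
Proof. by move=> a x y; rewrite /coef linearP. Qed.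
HB.instance Definition _ i :=
  GRing.isLinear.Build T freemod T^o *:%R (coef i) (coef_is_linear i).

Lemma coef_eq (x y : freemod) : (forall i, coef i x = coef i y) -> x = y.
Proof. by move=> xy; apply/val_inj/funext/xy. Qed.

Lemma supp_subproof (x : freemod) :
  exists s : seq I, uniq s /\ forall i, (i \in s) = (coef i x != 0).
Proof.
have [s xs] := submodP x; exists (undup [seq i <- s | coef i x != 0]).
split; first exact: undup_uniq.
move=> i; rewrite mem_undup mem_filter; apply/andb_idr; exact: xs.
Qed.

Definition supp (x : freemod) : seq I := projT1 (cid (supp_subproof x)).

Lemma supp_uniq x : uniq (supp x).
Proof. by rewrite /supp; case: cid => s []. Qed.

Lemma mem_supp x i : (i \in supp x) = (coef i x != 0).
Proof. by rewrite /supp; case: cid => s [? /= ->]. Qed.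

Lemma basis_subproof (i : I) : finitely_supported (fun j => (i == j)%:R).
Proof.
by exists [:: i] => j; rewrite inE; apply: contra_neqT; rewrite eq_sym => /negPf ->.
Qed.

Definition basis (i : I) : freemod :=
  Submod finitely_supported_submodule (basis_subproof i).

Lemma coef_basis i j : coef i (basis j) = (j == i)%:R.
Proof. by []. Qed.

Section Lift.
Variables (X : lmodType T) (g : I -> X).

Definition lift (x : freemod) : X := \sum_(i <- supp x) (coef i x : T) *: g i.

(** Several vectors can then share one index list, so that linearity of [lift] is checked
    termwise. *)
Lemma lift_sum (s : seq I) (x : freemod) :
  uniq s -> {subset supp x <= s} -> lift x = \sum_(i <- s) (coef i x : T) *: g i.
Proof.
move=> us xs; rewrite [RHS](bigID (mem (supp x))) /= [X in _ + X]big1 ?addr0.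
  rewrite -[RHS]big_filter; apply: perm_big; apply: uniq_perm.
  - exact: supp_uniq.
  - exact: filter_uniq.
  by move=> i; rewrite mem_filter andb_idr //; exact: xs.
by move=> i; rewrite mem_supp negbK => /eqP ->; rewrite scale0r.
Qed.

Lemma lift_is_linear : linear lift.
Proof.
move=> a x y; pose s := undup (supp (a *: x + y) ++ supp x ++ supp y).
rewrite !(@lift_sum s) ?undup_uniq //; first last.
- by move=> i; rewrite mem_undup !mem_cat => ->.
- by move=> i; rewrite mem_undup !mem_cat => ->; rewrite orbT.
- by move=> i; rewrite mem_undup !mem_cat => ->; rewrite !orbT.
rewrite scaler_sumr -big_split /=; apply: eq_bigr => i _.
by rewrite linearP scalerDl scalerA.
Qed.

HB.instance Definition _ :=
  GRing.isLinear.Build T freemod X *:%R lift lift_is_linear.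

Lemma liftE x : lift x = \sum_(i <- supp x) (coef i x : T) *: g i.
Proof. by []. Qed.

Lemma lift_basis i : lift (basis i) = g i.
Proof.
rewrite (@lift_sum [:: i]) ?big_seq1 ?coef_basis ?eqxx ?scale1r //.
by move=> j; rewrite mem_supp coef_basis inE; apply: contra_neqT; rewrite eq_sym => /negPf ->.
Qed.
End Lift.

Lemma free_sum (x : freemod) : x = \sum_(i <- supp x) (coef i x : T) *: basis i.
Proof.
apply: coef_eq => j; rewrite linear_sum /=.
have [js|js] := boolP (j \in supp x).
  rewrite (bigD1_seq j) ?supp_uniq //= linearZ /= coef_basis eqxx big1 ?addr0.
    by rewrite /GRing.scale /= mulr1.
  by move=> i /negPf ij; rewrite linearZ /= coef_basis ij scaler0.
rewrite big1_seq; first by apply/eqP; move: js; rewrite mem_supp negbK.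
move=> i /andP[_ xi]; rewrite linearZ /= coef_basis.
by case: eqP xi js => [-> ->//|]; rewrite scaler0.
Qed.

Lemma lift_exists (X : lmodType T) (g : I -> X) :
  exists h : {linear freemod -> X}, forall i, h (basis i) = g i.
Proof. by exists (lift g) => i /=; rewrite lift_basis. Qed.

Lemma linear_eq_on_supp (X : lmodType T) (f g : {linear freemod -> X}) x :
  (forall i, coef i x != 0 -> f (basis i) = g (basis i)) -> f x = g x.
Proof.
move=> fg; rewrite [x]free_sum !linear_sum; apply: eq_big_seq => i.
by rewrite mem_supp !linearZ => /fg ->.
Qed.

Lemma lift_ext (X : lmodType T) (f g : {linear freemod -> X}) :
  (forall i, f (basis i) = g (basis i)) -> forall x, f x = g x.
Proof. by move=> fg x; apply: linear_eq_on_supp => i _. Qed.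

End FreeModule.

Lemma coef_lift (T : pzRingType) (I J : choiceType) (g : I -> freemod T J) j x :
  coef j (lift g x) = lift (fun i => coef j (g i)) x.
Proof.
by rewrite !liftE linear_sum; apply: eq_bigr => i _; rewrite linearZ.
Qed.

(** * Vanishing of Ext in terms of a single presentation *)

Section Maps.
Variable T : pzRingType.
Implicit Types A B C K M P X : lmodType T.

Lemma kernel_submodule A B (f : {linear A -> B}) :
  is_submodule [set x | f x = 0].
Proof.
by split=> [|a u v /= fu fv] /=; rewrite ?linear0 // linearP fu fv scaler0 addr0.
Qed.

Lemma range_submodule A B (f : {linear A -> B}) : is_submodule (range f).
Proof.
split; first by exists 0; rewrite ?linear0.
by move=> a _ _ [x _ <-] [y _ <-]; exists (a *: x + y); rewrite ?linearP.
Qed.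

Definition surj A B (f : {linear A -> B}) := forall b, exists a, f a = b.

Definition exact A B C (f : {linear A -> B}) (g : {linear B -> C}) :=
  forall x, g x = 0 <-> exists y, f y = x.

Definition inj0 A B (f : {linear A -> B}) := forall x, f x = 0 -> x = 0.

(** When [A -> B -> M -> 0] is exact and [B] is projective, this is the vanishing of Ext^1(M, X): a
    map on [A] killing the kernel of [a] is a map on the first syzygy of [M], and it must extend to
    [B]. *)
Definition ext_along A B (a : {linear A -> B}) X :=
  forall f : {linear A -> X}, (forall y, a y = 0 -> f y = 0) ->
  exists g : {linear B -> X}, forall x, f x = g (a x).

Lemma id_sub_linear A (g : {linear A -> A}) : linear (fun x => x - g x).
Proof.
by move=> t x y; rewrite [g _]linearP opprD scalerBr addrACA.
Qed.

(** [f] descends to the image of [a], and [h] is the descended map composed with [u]. *)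
Lemma factor_through_image A B C X (u : {linear C -> B}) (a : {linear A -> B})
    (f : {linear A -> X}) :
  (forall c, exists y, a y = u c) -> (forall y, a y = 0 -> f y = 0) ->
  exists h : {linear C -> X}, forall c y, a y = u c -> h c = f y.
Proof.
move=> /choice[s as_] f0.
have fE c y : a y = u c -> f (s c) = f y.
  move=> ay; apply/eqP; rewrite -subr_eq0 -linearB; apply/eqP/f0.
  by rewrite linearB as_ ay subrr.
have hlin : linear (f \o s).
  by move=> t x y /=; rewrite -linearP; apply: fE; rewrite !linearP !as_.
by exists (lin hlin) => c y /fE.
Qed.

Lemma projective_lift A B P (u : {linear P -> B}) (a : {linear A -> B}) :
  projective P -> (forall c, exists y, a y = u c) ->
  exists v : {linear P -> A}, forall c, a (v c) = u c.
Proof.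
move=> projP ua; pose N := submod (range_submodule a).
have a_lin : linear (fun x => Submod (range_submodule a) (imageT a x) : N).
  by move=> t x y; apply: val_inj => /=; rewrite linearP.
have uN c : range a (u c) by case: (ua c) => y <-; exists y.
have u_lin : linear (fun x => Submod (range_submodule a) (uN x) : N).
  by move=> t x y; apply: val_inj => /=; rewrite linearP.
have [|v av] := projP _ _ (lin a_lin) (lin u_lin).
  by move=> z; have [y _ yz] := submodP z; exists y; apply: val_inj.
by exists v => c; have /(congr1 val) := av c.
Qed.

Lemma projective_retract K P (i : {linear K -> P}) (r : {linear P -> K}) :
  cancel i r -> projective P -> projective K.
Proof.
move=> ri projP A B g f surjg; have [h gh] := projP _ _ g (f \o r) surjg.
by exists (h \o i) => x /=; rewrite gh /= ri.
Qed.

Lemma projective_free (I : choiceType) : projective (freemod T I).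
Proof.
move=> A B g f surjg; have /choice[s gs] : forall i, exists y, g y = f (basis T i).
  by move=> i; exact: surjg.
exists (lift s).
by apply: (@lift_ext _ _ _ (g \o lift s)) => i /=; rewrite lift_basis gs.
Qed.

Lemma projective_pair P P' : projective P -> projective P' ->
  projective (P * P')%type.
Proof.
move=> projP projP' A B g f surjg.
have inl_lin : linear (fun x : P => (x, 0 : P')).
  by move=> a x y; congr pair; rewrite /= scaler0 addr0.
have inr_lin : linear (fun x : P' => (0 : P, x)).
  by move=> a x y; congr pair; rewrite /= scaler0 addr0.
have [h gh] := projP _ _ g (f \o lin inl_lin) surjg.
have [h' gh'] := projP' _ _ g (f \o lin inr_lin) surjg.
have hh_lin : linear (fun z : P * P' => h z.1 + h' z.2).
  by move=> a x y /=; rewrite !linearP scalerDr addrACA.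
exists (lin hh_lin) => -[x y] /=; rewrite linearD gh gh' /= -linearD.
by congr (f _); congr pair; rewrite ?add0r ?addr0.
Qed.

Definition short_presentation P1 P0 M (a : {linear P1 -> P0})
    (p : {linear P0 -> M}) :=
  [/\ projective P0, surj p & exact a p].

Section Comparison.
Variables (M P P' A A' : lmodType T).
Variables (a : {linear A -> P}) (p : {linear P -> M}).
Variables (a' : {linear A' -> P'}) (p' : {linear P' -> M}).
Hypothesis (ap : short_presentation a p) (ap' : short_presentation a' p').

Lemma comparison : exists2 alpha : {linear P -> P'},
  (forall x, p' (alpha x) = p x) & forall y, exists y', a' y' = alpha (a y).
Proof.
case: ap ap' => projP _ exa [_ surjp' exa'].
have [alpha pa] := projP _ _ p' p surjp'; exists alpha => // y.
by apply/exa'; rewrite pa; apply/exa; exists y.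
Qed.
End Comparison.

(** Comparison maps go both ways, and [id - be \o al] lands in the image of [a']. The extension is
    the one found on [P], pulled back along [al], plus the correction [k] that [f'] induces through
    this difference. *)
Lemma ext_along_indep M P P' A A' X
    (a : {linear A -> P}) (p : {linear P -> M})
    (a' : {linear A' -> P'}) (p' : {linear P' -> M}) :
  short_presentation a p -> short_presentation a' p' ->
  ext_along a X -> ext_along a' X.
Proof.
move=> ap ap' exta f' f'0.
have [al pal _] := comparison ap' ap; have [be pbe aalbe] := comparison ap ap'.
have [h hf] := factor_through_image (u := be \o a) aalbe f'0.
have [y ay|g gh] := exta h.
  by rewrite (hf y 0) ?linear0 //= ay !linear0.
have d_lin := id_sub_linear (be \o al).
have [|k kf] := factor_through_image (u := lin d_lin) _ f'0.
  move=> x; case: ap' => _ _ exa'; apply/exa'.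
  by rewrite linearB /= pbe pal subrr.
have g_lin : linear (fun x => g (al x) + k x).
  by move=> t x y; rewrite !linearP scalerDr addrACA.
exists (lin g_lin) => y /=.
have [z az] : exists z, a z = al (a' y).
  by case: ap ap' => _ _ exa [_ _ exa']; apply/exa; rewrite pal; apply/exa'; exists y.
have [w aw] := aalbe z; rewrite /= in aw.
rewrite -az -gh (hf z w) //= (kf _ (y - w)) ?linearB /=; last first.
  by rewrite aw az.
by rewrite addrC subrK.
Qed.

(** The half of Schanuel's lemma that serves below: [a y |-> (a y, e y)] and
    [(x, z) |-> a (c x + d z)] exhibit the image of [a] as a retract of the product of [P] and
    [A']. *)
Lemma schanuel M P P' A A' (a : {linear A -> P}) (p : {linear P -> M})
    (a' : {linear A' -> P'}) (p' : {linear P' -> M}) :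
  short_presentation a p -> short_presentation a' p' ->
  projective A' -> inj0 a' ->
  exists (c : {linear P -> A}) (d : {linear A' -> A}) (e : {linear A -> A'}),
    (forall y, a (c (a y) + d (e y)) = a y) /\
    (forall y, a y = 0 -> e y = 0).
Proof.
move=> ap ap' projA' inja'.
have [al pal aal] := comparison ap ap'; have [be pbe abe] := comparison ap' ap.
have [projP surjp exa] := ap.
have d_lin := id_sub_linear (be \o al).
have [|c ac] := projective_lift (u := lin d_lin) (a := a) projP.
  by move=> x; apply/exa; rewrite linearB /= pbe pal subrr.
have [d ad] := projective_lift (u := be \o a') (a := a) projA' abe.
have [|e ae] := factor_through_image (u := al \o a) (f := idfun) aal.
  by move=> y /inja'.
have a'e y : a' (e y) = al (a y).
  by have [y' ay'] := aal y; rewrite (ae _ _ ay').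
exists c, d, e; split=> y; first by rewrite linearD ac ad /= a'e subrK.
by move=> ay; apply: inja'; rewrite a'e ay linear0.
Qed.

(** [s] factors through the image of [a] and is a section there, so the kernel of [a] is a direct
    summand with projection [y |-> y - s y]. *)
Definition splits A B (a : {linear A -> B}) :=
  exists s : {linear A -> A},
    (forall y, a (s y) = a y) /\ (forall y, a y = 0 -> s y = 0).

(** [f] descends to the image of [d], which is the kernel of [a]; the projection [id - s] onto that
    kernel extends it to [A]. *)
Lemma splits_ext_along A B C X (d : {linear C -> A}) (a : {linear A -> B}) :
  exact d a -> splits a -> ext_along d X.
Proof.
move=> exd [s [as_ s0]] f f0.
have u_lin := id_sub_linear s.
have [|h hf] := factor_through_image (u := lin u_lin) _ f0.
  by move=> x; apply/exd; rewrite linearB /= as_ subrr.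
exists h => y; rewrite (hf _ y) //= s0 ?subr0 //.
by apply/exd; exists y.
Qed.

(** Projectivity of [A] lifts the projection [id - s] onto the image of [d] to a section of [d], so
    splitting climbs a resolution. *)
Lemma splits_next A B C (d : {linear C -> A}) (a : {linear A -> B}) :
  projective A -> exact d a -> splits a -> splits d.
Proof.
move=> projA exd [s [as_ s0]].
have u_lin := id_sub_linear s.
have [|r dr] := projective_lift (u := lin u_lin) (a := d) projA.
  by move=> x; apply/exd; rewrite linearB /= as_ subrr.
exists (r \o d); split=> y /=; last by move=> ->; rewrite linear0.
by rewrite dr /= s0 ?subr0 //; apply/exd; exists y.
Qed.

End Maps.

Section Resolutions.
Variable T : pzRingType.
Implicit Types A B C K M P X : lmodType T.

Lemma short_presentation_res M (P : projective_resolution M) :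
  short_presentation (res_d P 0) (res_aug P).
Proof.
split; [exact: res_projective | exact: res_aug_surj | exact: res_exact0].
Qed.

Lemma cohomology_ext_along M X (P : projective_resolution M) n :
  Hom_cohomology_vanishes X P n.+1 <-> ext_along (res_d P n) X.
Proof.
split=> H f f0.
  have f0' y : f (res_d P n.+1 y) = 0 by apply: f0; apply/res_exactS; exists y.
  by case: (H f f0') => g fg; exists g.
by apply: H => _ /res_exactS[z <-].
Qed.

(** [Ext_vanishes] quantifies over all resolutions, so it yields information only once one is
    available. Each term is free on the elements of the preceding kernel. *)
Lemma resolution_exists M : inhabited (projective_resolution M).
Proof.
pose step A B (d : {linear A -> B}) : {linear freemod T (submod (kernel_submodule d)) -> A} :=
  val \o lift (idfun : submod (kernel_submodule d) -> submod _).
pose st0 := existT (fun A => {B : lmodType T & {linear A -> B}}) _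
   (existT _ _ (step _ _ (lift (idfun : M -> M)))).
pose st := fix st n := match n with
  | 0%N => st0
  | n.+1 => existT (fun A => {B : lmodType T & {linear A -> B}}) _
     (existT _ _ (step _ _ (projT2 (projT2 (st n)))))
  end.
have step_exact A B (d : {linear A -> B}) : exact (step _ _ d) d.
  move=> x; split=> [dx|[y <-]]; last exact: (@submodP _ _ _ (kernel_submodule d)).
  by exists (basis T (Submod (kernel_submodule d) dx)); rewrite /= lift_basis.
pose obj n : lmodType T := projT1 (projT2 (st n)).
pose d n : {linear obj n.+1 -> obj n} := projT2 (projT2 (st n)).
split; apply: (@ProjectiveResolution _ _ obj d (lift (idfun : M -> M))).
- by case=> [|[|n]]; exact: projective_free.
- by move=> m; exists (basis T m); rewrite /= lift_basis.
- by move=> x; exact: step_exact.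
- by move=> n x; exact: step_exact.
Qed.

Lemma Ext1_ext_along M X A P (a : {linear A -> P}) (p : {linear P -> M}) :
  short_presentation a p -> Ext_vanishes 1 M X <-> ext_along a X.
Proof.
move=> ap; split=> [E|E R]; last first.
  apply/cohomology_ext_along; apply: ext_along_indep ap _ E.
  exact: short_presentation_res.
have [R] := resolution_exists M.
have /cohomology_ext_along := E R.
exact: ext_along_indep (short_presentation_res R) ap.
Qed.

(** The equalities in degrees 0 and 1 let countable generation of [P0] and [P1] be transported to
    the resolution. *)
Lemma short_resolution M P0 P1 (a : {linear P1 -> P0}) (p : {linear P0 -> M}) :
  short_presentation a p -> projective P1 -> inj0 a ->
  exists R : projective_resolution M,
    [/\ res_obj R 0 = P0, res_obj R 1 = P1 & forall k, (1 < k)%N -> forall x : R k, x = 0].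
Proof.
move=> [projP0 surjp exa] projP1 inja.
pose Z : lmodType T := freemod T void.
have Z0 (z : Z) : z = 0 by apply: coef_eq.
pose obj n := match n with 0 => P0 | 1 => P1 | _ => Z end.
have z_lin A B : linear (fun _ : A => 0 : B).
  by move=> t x y; rewrite scaler0 addr0.
pose d n : {linear obj n.+1 -> obj n} :=
  match n with 0 => a | n.+1 => lin (z_lin (obj n.+2) (obj n.+1)) end.
have obj_projective n : projective (obj n).
  by case: n => [|[|n]] //; exact: projective_free.
have d_exact n x : d n x = 0 <-> exists y, d n.+1 y = x.
  case: n x => [|n] x; split=> [x0|[y <-]]; rewrite /= ?linear0 //.
  by exists 0; rewrite (inja _ x0).
exists (ProjectiveResolution obj_projective surjp exa d_exact).
by split=> //; case=> [|[|k]] // _ x; exact: Z0.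
Qed.

Lemma pdim1P M : pdim_le 1 M <->
  exists (P1 P0 : lmodType T) (a : {linear P1 -> P0}) (p : {linear P0 -> M}),
    [/\ short_presentation a p, projective P1 & inj0 a].
Proof.
split=> [[R R0]|[P1 [P0 [a [p [ap projP1 inja]]]]]].
  exists (res_obj R 1), (res_obj R 0), (res_d R 0), (res_aug R); split.
  - exact: short_presentation_res.
  - exact: res_projective.
  - move=> x /res_exactS[y <-]; suff -> : y = 0 by rewrite linear0.
    exact: R0.
by have [R [_ _ R0]] := short_resolution ap projP1 inja; exists R.
Qed.

(** Schanuel's lemma against a presentation with injective [a] splits [res_d R 0]; the splitting
    then climbs the resolution. *)
Lemma pdim1_Ext_high M X n : pdim_le 1 M -> Ext_vanishes n.+2 M X.
Proof.
move=> /pdim1P[P1 [P0 [a [p [ap projP1 inja]]]]] R; apply/cohomology_ext_along.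
apply: (splits_ext_along (a := res_d R n)); first exact: res_exactS.
elim: n => [|n IHn]; last first.
  by apply: splits_next IHn; [exact: res_projective | exact: res_exactS].
have [c [d [e [ace e0]]]] :=
  schanuel (short_presentation_res R) ap projP1 inja.
have s_lin : linear (fun y => c (res_d R 0 y) + d (e y)).
  by move=> t x y; rewrite !linearP scalerDr addrACA.
exists (lin s_lin); split=> //= y dy.
by rewrite dy e0 // !linear0 addr0.
Qed.

End Resolutions.

(** * Free presentations of modules of projective dimension 1 *)

Section Swindle.
Variable T : pzRingType.

Lemma syzygy_projective (M A P : lmodType T) (a : {linear A -> P})
    (p : {linear P -> M}) :
  short_presentation a p -> inj0 a -> pdim_le 1 M -> projective A.
Proof.
move=> ap inja /pdim1P[P1 [P0 [a' [p' [ap' projP1 inja']]]]].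
have [c [d [e [ace _]]]] := schanuel ap ap' projP1 inja'.
have i_lin : linear (fun y => (a y, e y)).
  by move=> t x y; rewrite !linearP.
have r_lin : linear (fun z : P * P1 => c z.1 + d z.2).
  by move=> t x y; rewrite /= !linearP scalerDr addrACA.
apply: (@projective_retract _ _ _ (lin i_lin) (lin r_lin)).
  move=> y; apply/eqP; rewrite -subr_eq0; apply/eqP/inja.
  by rewrite linearB /= ace subrr.
by apply: projective_pair => //; case: ap.
Qed.

(* Eilenberg's swindle: writing [L = H + H'] with [L] free, the modules       *)
(* [H + L^(nat)] and [L^(nat)] are isomorphic, so that adding [L^(nat)] to    *)
(* both sides of [v : H -> F] makes the source free without changing the      *)
(* cokernel.                                                                  *)
Lemma swindle (H : lmodType T) (J : choiceType) (v : {linear H -> freemod T J}) :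
  inj0 v -> projective H ->
  exists (I K : choiceType) (u : {linear freemod T I -> freemod T K})
    (q : {linear freemod T K -> freemod T J}) ,
  [/\ inj0 u, surj q & forall z, (exists x, u x = z) <-> (exists h, v h = q z)].
Proof.
move=> injv projH.
pose Lw := freemod T (nat * H)%type; pose FJ := freemod T (J + nat * H)%type.
have [r rE] := lift_exists (idfun : H -> H).
have [i ri] : exists i : {linear H -> freemod T H}, cancel i r.
  apply: (projective_lift (u := idfun) projH) => h.
  by exists (basis T h); rewrite rE.
have /choice[inn innE] (n : nat) := lift_exists (fun h : H => basis T (n, h)).
have [E EE_] := lift_exists (fun nh : nat * H => inn nh.1 (i nh.2)).
have [down downE] :=
  lift_exists (fun nh : nat * H => if nh.1 is n.+1 then basis T (n, nh.2) else 0).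
have [up upE] := lift_exists (fun nh : nat * H => basis T (nh.1.+1, nh.2)).
have [r0 r0E] := lift_exists (fun nh : nat * H => if nh.1 is 0 then nh.2 else 0).
have [inl_ inlE] := lift_exists (fun j : J => basis T (inl j : J + nat * H)).
have [inr_ inrE] := lift_exists (fun nh : nat * H => basis T (inr nh : J + nat * H)).
have [prl prlE] := lift_exists
  (fun x : (J + nat * H)%type => if x is inl j then basis T j else 0).
have [prr prrE] := lift_exists
  (fun x : (J + nat * H)%type => if x is inr nh then basis T nh else 0).
(* [E] is the idempotent [i \o r] on every copy of [L]; the identities below describe it against the
   shifts [up] and [down]. *)
have E_inn n x : E (inn n x) = inn n (i (r x)).
  by apply: (@lift_ext _ _ _ (E \o inn n) (inn n \o i \o r)) => h /=; rewrite innE EE_ rE.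
have EE x : E (E x) = E x.
  by apply: (@lift_ext _ _ _ (E \o E) E) => -[n h] /=; rewrite EE_ E_inn ri.
have down_inn n x : down (inn n x) = if n is m.+1 then inn m x else 0.
  case: n => [|n].
    by apply: (@lift_ext _ _ _ (down \o inn 0) \0) => h /=; rewrite innE downE.
  by apply: (@lift_ext _ _ _ (down \o inn n.+1) (inn n)) => h /=; rewrite !innE downE.
have E_down x : E (down x) = down (E x).
  apply: (@lift_ext _ _ _ (E \o down) (down \o E)) => -[[|n] h] /=.
    by rewrite downE EE_ linear0 down_inn.
  by rewrite downE !EE_ down_inn.
have down_up x : down (up x) = x.
  by apply: (@lift_ext _ _ _ (down \o up) idfun) => -[n h] /=; rewrite upE downE.
have up_inn n x : up (inn n x) = inn n.+1 x.
  by apply: (@lift_ext _ _ _ (up \o inn n) (inn n.+1)) => h /=; rewrite !innE upE.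
have E_up x : E (up x) = up (E x).
  apply: (@lift_ext _ _ _ (E \o up) (up \o E)) => -[n h] /=.
  by rewrite upE !EE_ up_inn.
have r0_inn n x : r0 (inn n x) = if n is 0 then r x else 0.
  case: n => [|n].
    by apply: (@lift_ext _ _ _ (r0 \o inn 0) r) => h /=; rewrite innE r0E rE.
  by apply: (@lift_ext _ _ _ (r0 \o inn n.+1) \0) => h /=; rewrite innE r0E.
have r0_E x : r0 (E x) = r0 x.
  by apply: (@lift_ext _ _ _ (r0 \o E) r0) => -[[|n] h] /=; rewrite EE_ r0_inn r0E ?ri.
have r0_up x : r0 (up x) = 0.
  by apply: (@lift_ext _ _ _ (r0 \o up) \0) => -[n h] /=; rewrite upE r0E.
have E_split x : E x = inn 0 (i (r0 x)) + up (down (E x)).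
  apply: (@lift_ext _ _ _ E ((inn 0%N \o i \o r0) \+ (up \o down \o E))) => -[n h] /=.
  rewrite EE_ r0E down_inn; case: n => [|n] /=.
    by rewrite linear0 addr0.
  by rewrite !linear0 add0r up_inn.
have prl_inl x : prl (inl_ x) = x.
  by apply: (@lift_ext _ _ _ (prl \o inl_) idfun) => j /=; rewrite inlE prlE.
have prl_inr x : prl (inr_ x) = 0.
  by apply: (@lift_ext _ _ _ (prl \o inr_) \0) => j /=; rewrite inrE prlE.
have prr_inl x : prr (inl_ x) = 0.
  by apply: (@lift_ext _ _ _ (prr \o inl_) \0) => j /=; rewrite inlE prrE.
have prr_inr x : prr (inr_ x) = x.
  by apply: (@lift_ext _ _ _ (prr \o inr_) idfun) => j /=; rewrite inrE prrE.
have pr_split x : x = inl_ (prl x) + inr_ (prr x).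
  apply: (@lift_ext _ _ _ idfun ((inl_ \o prl) \+ (inr_ \o prr))) => -[j|nh] /=.
    by rewrite prlE prrE linear0 addr0 inlE.
  by rewrite prlE prrE linear0 add0r inrE.
(* [H'] stays fixed in every copy, copy [n.+1] of [H] moves to copy [n], and copy 0 of [H] is sent
   to [F] by [v]. *)
pose u x := inl_ (v (r0 x)) + inr_ (x - E x + E (down x)).
have u_lin : linear u.
  move=> t x y; rewrite /u id_sub_linear.
  have -> : E (down (t *: x + y)) = t *: E (down x) + E (down y).
    by rewrite !linearP.
  by rewrite [_ + (y - E y) + _]addrACA -scalerDr !linearP scalerDr addrACA.
exists (nat * H)%type, (J + nat * H)%type, (lin u_lin), prl; split.
- move=> x /= ux.
  have : prl (u x) = 0 by rewrite ux linear0.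
  rewrite linearD prl_inl prl_inr addr0 => /injv r0x.
  have : prr (u x) = 0 by rewrite ux linear0.
  rewrite linearD prr_inl prr_inr add0r => xE.
  (* Applying [E] separates the [H] part of the second component from its [H'] part. *)
  have : E (x - E x + E (down x)) = 0 by rewrite xE linear0.
  rewrite linearD linearB !EE subrr add0r => Edx.
  have Ex0 : E x = 0 by rewrite E_split r0x -E_down Edx !linear0 addr0.
  by move: xE; rewrite Ex0 Edx subr0 addr0.
- by move=> y; exists (inl_ y).
move=> z; split=> [[x <-]|[h vh]].
  by exists (r0 x); rewrite /= linearD prl_inl prl_inr addr0.
set m := prr z; pose k := inn 0 (i h).
have Ek : E k = k by rewrite E_inn ri.
have r0k : r0 k = h by rewrite r0_inn ri.
have downk : down k = 0 by rewrite down_inn.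
(* Undo the shift: [h] goes to copy 0, the [H'] part of [m] stays, and its [H] part moves up. *)
pose x := k + (m - E m) + up (E m); exists x; rewrite /= /u.
have Ex : E x = k + up (E m).
  by rewrite /x linearD linearD Ek linearB EE subrr addr0 E_up EE.
have r0x : r0 x = h.
  by rewrite /x linearD linearD linearB r0_E r0_up subrr !addr0.
have Edx : E (down x) = E m.
  rewrite E_down Ex linearD downk add0r.
  exact: down_up.
rewrite r0x Ex Edx vh [RHS]pr_split -/m; congr (_ + inr_ _).
by rewrite /x opprD addrACA [k + _]addrC addrK subrr addr0 subrK.
Qed.

Lemma free_presentation (M : lmodType T) : pdim_le 1 M ->
  exists (I J : choiceType) (u : {linear freemod T I -> freemod T J})
    (p : {linear freemod T J -> M}), short_presentation u p /\ inj0 u.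
Proof.
move=> pdM; pose p : {linear freemod T M -> M} := lift (idfun : M -> M).
have surjp : surj p by move=> m; exists (basis T m); rewrite /= lift_basis.
pose K := submod (kernel_submodule p).
pose a : {linear K -> freemod T M} := val.
have inja : inj0 a by move=> x ax0; apply: val_inj; rewrite linear0.
have exa : exact a p.
  move=> x; split=> [px|[y <-]]; last exact: (@submodP _ _ _ (kernel_submodule p)).
  by exists (Submod (kernel_submodule p) px).
have ap : short_presentation a p by split=> //; exact: projective_free.
have [I [J [u [q [inju surjq uq]]]]] :=
  swindle inja (syzygy_projective ap inja pdM).
exists I, J, u, (p \o q); split=> //; split; first exact: projective_free.
  by move=> m; have [y <-] := surjp m; have [z <-] := surjq y; exists z.
by move=> z; rewrite uq; exact: exa.
Qed.
End Swindle.

(** * Countable generation up to denominators *)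

Section Span.
Variables (T : pzRingType) (M : lmodType T).

Lemma span_submodule (G : set M) : is_submodule (submodule_span G).
Proof.
split; first by move=> N [[N0 _] _].
move=> a u v Gu Gv N [NN GN].
by apply: (proj2 NN); [apply: Gu | apply: Gv].
Qed.

Lemma sub_span (G : set M) : G `<=` submodule_span G.
Proof. exact: sub_smallest. Qed.

Lemma span_sub (G N : set M) : is_submodule N -> G `<=` N -> submodule_span G `<=` N.
Proof. exact: smallest_sub. Qed.

Lemma span_mono (G G' : set M) : G `<=` G' -> submodule_span G `<=` submodule_span G'.
Proof.
move=> GG'; apply: span_sub (span_submodule _) _.
exact: subset_trans GG' (@sub_span _).
Qed.

Lemma submoduleD (N : set M) x y : is_submodule N -> N x -> N y -> N (x + y).
Proof. by move=> NN Nx Ny; rewrite -[x]scale1r; apply: (proj2 NN). Qed.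

Lemma submoduleZ (N : set M) a x : is_submodule N -> N x -> N (a *: x).
Proof. by move=> NN Nx; rewrite -[_ *: _]addr0; apply: (proj2 NN) => //; case: NN. Qed.

Lemma submoduleB (N : set M) x y : is_submodule N -> N x -> N y -> N (x - y).
Proof. by move=> NN Nx Ny; rewrite -scaleN1r addrC; apply: (proj2 NN). Qed.

End Span.

Lemma span_image (T : pzRingType) (M B : lmodType T) (G : set M) (f : {linear M -> B}) y :
  submodule_span (f @` G) y -> exists2 x, submodule_span G x & f x = y.
Proof.
move=> Gy; pose N := [set y | exists2 x, submodule_span G x & f x = y].
suff NN : is_submodule N.
  have GN : f @` G `<=` N by move=> _ [x Gx <-]; exists x => //; exact: sub_span.
  exact: (span_sub NN GN Gy).
split; first by exists 0; [exact: (proj1 (span_submodule _)) | rewrite linear0].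
move=> a _ _ [x Gx <-] [z Gz <-]; exists (a *: x + z); last by rewrite linearP.
exact: (proj2 (span_submodule _)).
Qed.

(* [S^-1 T] is left aleph_0-noetherian, expressed without denominators.       *)
Definition fractions_aleph0_noetherian (T : pzRingType) (S : set T) : Prop :=
  forall I : set T^o, is_submodule I -> exists W : set T^o,
    [/\ countable W, W `<=` I &
        forall x : T^o, I x -> exists2 s, S s & submodule_span W (s *: x)].

Section Denominators.
Variables (T : pzRingType) (S : set T).
Hypotheses (S1 : S 1) (SM : forall s t, S s -> S t -> S (s * t)).
Hypothesis S_noeth : fractions_aleph0_noetherian S.
Variable M : lmodType T.

(* Filter [V] by the last nonvanishing coordinate.                            *)
Lemma countable_generation_by_coordinates (V : set M)
    (c : nat -> {linear M -> T^o}) :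
  is_submodule V ->
  (forall v, V v -> exists n, forall m, (n <= m)%N -> c m v = 0) ->
  exists W : set M, [/\ countable W, W `<=` V & forall v, V v ->
    exists s w, [/\ S s, submodule_span W w & forall n, c n (s *: v - w) = 0]].
Proof.
move=> VV Vfin.
pose Vn n := [set v | V v /\ forall m, (n < m)%N -> c m v = 0].
have VnV n : is_submodule (Vn n).
  split; first by split=> [|m _]; [exact: (proj1 VV) | rewrite linear0].
  move=> a u v [Vu u0] [Vv v0]; split; first exact: (proj2 VV).
  by move=> m nm; rewrite linearP u0 // v0 // scaler0 addr0.
(* The [n]-th coordinates of [Vn n] form a left ideal, whose generators up to denominators are
   lifted back to [Vn n]. *)
have Wn_exists n : exists Wn : set M, [/\ countable Wn, Wn `<=` Vn n &
    forall v, Vn n v -> exists s w,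
      [/\ S s, submodule_span Wn w & c n (s *: v - w) = 0]].
  have [|W [Wc WI Wgen]] := S_noeth (I := c n @` Vn n).
    split; first by exists 0; [exact: (proj1 (VnV n)) | rewrite linear0].
    move=> a _ _ [x Vx <-] [y Vy <-]; exists (a *: x + y); last by rewrite linearP.
    exact: (proj2 (VnV n)).
  have /choice[g gP] : forall y : T^o, exists x, W y -> Vn n x /\ c n x = y.
    move=> y; have [/WI[x Vx xy]|nWy] := pselect (W y); last by exists 0.
    by exists x.
  exists (g @` W); split.
  - exact: sub_countable (card_image_le _ _) Wc.
  - by move=> _ [y /gP[Vy _] <-].
  - move=> v Vv; have [s Ss Wsv] := Wgen _ (imageP (c n) Vv).
    have WE : W `<=` c n @` (g @` W).
      by move=> y Wy; exists (g y); [exists y | case: (gP y Wy)].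
    have /span_image[w Gw cw] := span_mono WE Wsv.
    by exists s, w; split=> //; rewrite linearB cw linearZ subrr.
have [Wn WnP] := choice Wn_exists.
pose W := \bigcup_n Wn n; have WW := span_submodule W.
have sub_W n : Wn n `<=` W by move=> x Wx; exists n.
have W_V : W `<=` V by move=> x [n _ Wx]; case: (WnP n) => _ /(_ _ Wx) [].
exists W; split=> //.
  by apply: bigcup_countable => // n _; case: (WnP n).
suff gen n v : V v -> (forall m, (n <= m)%N -> c m v = 0) ->
    exists s w, [/\ S s, submodule_span W w & forall n, c n (s *: v - w) = 0].
  by move=> v Vv; have [n] := Vfin _ Vv; exact: gen.
elim: n v => [|n IHn] v Vv v0.
  exists 1, 0; split=> //; first exact: (proj1 WW).
  by move=> n; rewrite subr0 scale1r v0.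
have [_ Wn_Vn /(_ v)[|s [w [Ss Ww sv0]]]] := WnP n; first by split.
have Vnw : Vn n w by apply: span_sub Ww.
(* Subtracting [w] kills coordinate [n]; the later ones stay zero because [w] lies in [Vn n]. *)
have [||s' [w' [Ss' Ww' sv'0]]] := IHn (s *: v - w).
- by apply: (submoduleB VV); [exact: (submoduleZ _ VV) | exact: (proj1 Vnw)].
- move=> m; rewrite leq_eqVlt => /predU1P[<- //|nm].
  by rewrite linearB linearZ /= v0 // (proj2 Vnw) // scaler0 subrr.
exists (s' * s), (s' *: w + w'); split; first exact: SM.
  by apply: (proj2 WW) => //; exact: span_mono Ww.
by move=> m; rewrite opprD addrA -scalerA -scalerBr.
Qed.
End Denominators.

Section RingOfFractions.
Variables (R : pzRingType) (S : set R).
Hypothesis S_regular : S `<=` @non_zero_divisors R.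
Hypothesis S_multiplicative : multiplicative_subset S.
Hypothesis S_Ore : right_Ore S.
Variables (Q : pzRingType) (phi : {rmorphism R -> Q}).
Hypothesis Q_fractions : is_right_ring_of_fractions S phi.
Hypothesis Q_noetherian : right_aleph0_noetherian Q.

Lemma phi_inj r : phi r = 0 -> r = 0.
Proof.
case: Q_fractions => _ _ kerphi /kerphi[s Ss rs0].
by have [_] := S_regular Ss; apply; rewrite rs0 mul0r.
Qed.

(** For a right ideal [I] this is [I Q], whose elements are single fractions [x s^-1]. *)
Definition extended_ideal (I : set R) : set Q :=
  [set q | exists2 s, S s & exists2 x, I x & q * phi s = phi x].

Lemma extended_ideal_right_ideal (I : set R) :
  right_ideal I -> right_ideal (extended_ideal I).
Proof.
have [invS fracQ _] := Q_fractions; have [S1 SM] := S_multiplicative.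
move=> II.
have ID x y : I x -> I y -> I (x + y) by move=> *; exact: (@submoduleD R^c R^c^o I x y).
have IM x (r : R) : I x -> I (x * r : R) by move=> Ix; exact: (@submoduleZ R^c R^c^o I r x II Ix).
split; first by exists 1 => //; exists 0; [case: II | rewrite mul0r rmorph0].
move=> a u v [s Ss [x Ix us]] [t St [y Iy vt]].
(* Scalars of [Q^c] act on [Q] by right multiplication. *)
change (extended_ideal I ((u : Q) * (a : Q) + v)).
have [r [s1 [b [Ss1 _ bs1 aE]]]] := fracQ a.
(* First use of the Ore condition: [s^-1 r = r1 s2^-1], whence [u a = x r1 (s1 s2)^-1]. *)
have [r1 [s2 [Ss2 rs]]] := S_Ore r Ss.
have uaE : (u : Q) * a * phi (s1 * s2) = phi (x * r1).
  rewrite aE !rmorphM -us -[RHS]mulrA -(rmorphM phi s) -rs rmorphM !mulrA.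
  by rewrite -[_ * b * _]mulrA bs1 mulr1.
(* Second use: the common denominator [s1 s2 s3 = t r3]. *)
have [r3 [s3 [Ss3 ts]]] := S_Ore (s1 * s2) St.
exists (s1 * s2 * s3); first exact: (SM _ _ (SM _ _ Ss1 Ss2) Ss3).
exists (x * r1 * s3 + y * r3); first exact: (ID _ _ (IM _ _ (IM _ _ Ix)) (IM _ _ Iy)).
rewrite mulrDl rmorphD; congr (_ + _).
  by rewrite rmorphM mulrA uaE -rmorphM.
by rewrite ts !rmorphM mulrA vt.
Qed.

(** [W] consists of numerators of countably many generators of [I Q]. An element of [I] then lies in
    [W Q], so some denominator brings it into the span of [W], and this holds in [R] since [phi] is
    injective. *)
Lemma fractions_noetherian : @fractions_aleph0_noetherian R^c S.
Proof.
have [S1 SM] := S_multiplicative => I II.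
have [G cG spanG] := Q_noetherian (extended_ideal_right_ideal II).
have /choice[w wP] : forall q : Q, exists x, G q ->
    I x /\ exists2 s, S s & q * phi s = phi x.
  move=> q; have [Gq|nGq] := pselect (G q); last by exists 0.
  have : extended_ideal I q by rewrite -spanG; exact: (@sub_span Q^c Q^c^o G q Gq).
  by case=> s Ss [x Ix qs]; exists x => _; split=> //; exists s.
exists (w @` G); split.
- exact: sub_countable (card_image_le _ _) cG.
- by move=> _ [q /wP[Iq _] <-].
move=> x Ix; have : extended_ideal I (phi x).
  by exists 1 => //; exists x => //; rewrite rmorph1 mulr1.
rewrite -spanG => /(span_sub (extended_ideal_right_ideal (span_submodule (w @` G)))).
case=> [q Gq|s Ss [y Wy xs]].
  have [_ [s Ss qs]] := wP _ Gq; exists s => //; exists (w q) => //.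
  by apply: sub_span; exists q.
have xsy : (x : R) * s = y.
  by apply/eqP; rewrite -subr_eq0; apply/eqP/phi_inj; rewrite rmorphB rmorphM xs subrr.
by exists s => //; rewrite -xsy in Wy.
Qed.
End RingOfFractions.

(** * Countable linear systems *)

Definition supported (T : pzRingType) (B : choiceType) (D : set B)
    (y : freemod T B) : Prop := forall b, coef b y != 0 -> D b.

Section Supported.
Variables (T : pzRingType) (A B : choiceType).
Implicit Type D : set B.

Lemma supported_submodule D : is_submodule (supported (T := T) D).
Proof.
split=> [b|a u v uD vD b]; first by rewrite linear0 eqxx.
rewrite linearP /=; have [u0|/uD //] := eqVneq (coef b u) 0.
have [v0|/vD //] := eqVneq (coef b v) 0.
by rewrite u0 v0 scaler0 addr0 eqxx.
Qed.

Lemma supported_sub D D' (y : freemod T B) : D `<=` D' -> supported D y -> supported D' y.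
Proof. by move=> DD' yD b /yD /DD'. Qed.

Lemma supported_linear D (u : {linear freemod T A -> freemod T B}) x :
  (forall a, coef a x != 0 -> supported D (u (basis T a))) -> supported D (u x).
Proof.
move=> uD b; apply: contraPP => nDb; apply/negP; rewrite negbK; apply/eqP.
apply: (@linear_eq_on_supp _ _ _ (coef b \o u) \0) => a xa /=.
by apply/eqP; apply: contrapT => /negP /(uD a xa).
Qed.

Lemma supported_countable (y : freemod T B) : countable [set b | coef b y != 0].
Proof.
apply: (@sub_countable _ _ _ [set` supp y]).
  by apply: subset_card_le => b /=; rewrite mem_supp.
exact/finite_set_countable/finite_seq.
Qed.

Lemma lift_eq_on_supp (X : lmodType T) (g g' : B -> X) (y : freemod T B) :
  (forall b, coef b y != 0 -> g b = g' b) -> lift g y = lift g' y.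
Proof.
by move=> gg'; apply: linear_eq_on_supp => b yb /=; rewrite !lift_basis gg'.
Qed.

Lemma lift_add (X : lmodType T) (g g' : B -> X) (y : freemod T B) :
  lift (fun b => g b + g' b) y = lift g y + lift g' y.
Proof.
apply: (@lift_ext _ _ _ (lift (fun b => g b + g' b)) (lift g \+ lift g')) => b /=.
by rewrite !lift_basis.
Qed.

Lemma lift_eq0 (X : lmodType T) (g : B -> X) (y : freemod T B) :
  (forall b, coef b y != 0 -> g b = 0) -> lift g y = 0.
Proof.
by move=> g0; apply: (@linear_eq_on_supp _ _ _ (lift g) \0) => b yb /=; rewrite lift_basis g0.
Qed.

End Supported.

(* The property [Ext^1(N, X) = 0] for the cokernels [N] of injective maps     *)
(* between free modules of countable rank; the summand [inr] only serves to   *)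
(* pad a countable set of relations to one indexed by [nat].                  *)
Definition solves_countable_systems (T : pzRingType) (X : lmodType T) : Prop :=
  forall c : nat -> freemod T (nat + nat)%type,
    (forall z, lift c z = 0 -> z = 0) ->
  forall f : nat -> X, exists g : nat + nat -> X, forall n, lift g (c n) = f n.

Section CountableSystem.
Variables (T : pzRingType) (X : lmodType T).
Hypothesis X_solves : solves_countable_systems X.

(** The equations in [A'], truncated to the unknowns in [B'], are numbered through injections into
    [nat]. A number without equation receives the padding relation [basis T (inr n)], which keeps
    the system independent. *)
Lemma solve_countable_subsystem (A B : choiceType) (A' : set A) (B' : set B)
    (u : {linear freemod T A -> freemod T B}) (f : A -> X) :
  countable A' -> countable B' ->
  (forall x, supported A' x -> (forall b, B' b -> coef b (u x) = 0) -> x = 0) ->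
  exists g : B -> X, (forall b, ~ B' b -> g b = 0) /\
    forall a, A' a -> lift g (u (basis T a)) = f a.
Proof.
move=> /countable_injP[psi psi_inj] /countable_injP[chi chi_inj] indep.
pose J := (nat + nat)%type.
have [tau tauE] := lift_exists
  (fun b => if `[< B' b >] then basis T (inl (chi b) : J) else 0).
pose P n a := A' a /\ psi a = n.
have PE n a a' : P n a -> P n a' -> a = a'.
  by move=> [Aa <-] [Aa' e]; apply: psi_inj; rewrite ?inE.
have /choice[al alP] : forall n, exists o : option A,
    if o is Some a then P n a else forall a, ~ P n a.
  move=> n; have [[a Pa]|nP] := pselect (exists a, P n a); first by exists (Some a).
  by exists None => a Pa; apply: nP; exists a.
have al_psi a : A' a -> al (psi a) = Some a.
  move=> Aa; have := alP (psi a); case: (al _) => [a' Pa'|/(_ a)]; last by case.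
  by congr Some; apply: PE Pa' _.
pose c n := if al n is Some a then tau (u (basis T a)) else basis T (inr n : J).
have coef_tau_inr n y : coef (inr n) (tau y) = 0.
  apply: (@lift_ext _ _ _ (coef (inr n : J) \o tau) \0) => b /=.
  by rewrite tauE; case: asboolP => _; rewrite ?linear0 // coef_basis.
have coef_tau_inl b y : B' b -> coef (inl (chi b)) (tau y) = coef b y.
  move=> Bb; apply: (@lift_ext _ _ _ (coef (inl (chi b) : J) \o tau) (coef b)) => b' /=.
  rewrite tauE; case: asboolP => [Bb'|nBb'].
    suff e : (inl (chi b') == inl (chi b) :> J) = (b' == b) by rewrite !coef_basis e.
    by apply/eqP/eqP => [[]|-> //]; apply: chi_inj; rewrite inE.
  by rewrite linear0 coef_basis; case: eqP Bb => // <-.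
have [sg sgE] := lift_exists (fun n => if al n is Some a then basis T a else 0).
have c_indep z : lift c z = 0 -> z = 0.
  move=> cz0.
  (* Only the padding relation [n] has a coordinate at [inr n]. *)
  have z_inr n : al n = None -> coef n z = 0.
    move=> aln; have : coef (inr n) (lift c z) = 0 by rewrite cz0 linear0.
    rewrite coef_lift => <-.
    apply: (@lift_ext _ _ _ (coef n) (lift _)) => m /=; rewrite lift_basis /c coef_basis.
    case: (eqVneq m n) => [->|mn]; first by rewrite aln coef_basis eqxx.
    case alm : (al m) => [a|]; first by rewrite coef_tau_inr.
    by rewrite coef_basis; case: eqP => // -[mn']; rewrite mn' eqxx in mn.
  have cE : lift c z = tau (u (sg z)).
    apply: (@linear_eq_on_supp _ _ _ (lift c) (tau \o u \o sg)) => n zn /=.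
    rewrite lift_basis sgE /c; case aln : (al n) => [a|] //.
    by rewrite (z_inr _ aln) eqxx in zn.
  have sg0 : sg z = 0.
    apply: indep => [a|b Bb]; last by rewrite -coef_tau_inl // -cE cz0 linear0.
    apply: contraPP => nAa; apply/negP; rewrite negbK; apply/eqP.
    apply: (@lift_ext _ _ _ (coef a \o sg) \0) => n /=; rewrite sgE.
    have := alP n; case: (al n) => [a' [Aa' _]|]; rewrite ?linear0 // coef_basis.
    by case: eqP => // aa'; rewrite aa' in Aa'.
  apply: coef_eq => n; rewrite linear0.
  case aln : (al n) => [a|]; last exact: z_inr.
  have <- : coef a (sg z) = coef n z; last by rewrite sg0 linear0.
  apply: (@lift_ext _ _ _ (coef a \o sg) (coef n)) => m /=.
  rewrite sgE coef_basis; have := alP n; have := alP m; rewrite aln.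
  case alm : (al m) => [a'|] Pm [Aa psia].
    rewrite coef_basis; suff -> : (a' == a) = (m == n) by [].
    apply/eqP/eqP => [aa'|mn].
      by case: Pm => _ <-; rewrite aa'.
    by move: alm; rewrite mn aln => -[].
  by rewrite linear0; case: eqP => // mn; case: (Pm a); rewrite mn.
have [g gE] := X_solves c_indep (fun n => if al n is Some a then f a else 0).
exists (fun b => if `[< B' b >] then g (inl (chi b)) else 0); split=> [b|a Aa].
  by case: asboolP.
have := gE (psi a); rewrite /c al_psi // => <-.
apply: (@lift_ext _ _ _ (lift _) (lift g \o tau)) => b /=.
by rewrite lift_basis tauE; case: asboolP => _; rewrite ?linear0 // lift_basis.
Qed.
End CountableSystem.

(** * Deconstruction into countable systems *)

Section Deconstruction.
Variables (T : pzRingType) (S : set T).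
Hypotheses (S1 : S 1) (SM : forall s t, S s -> S t -> S (s * t)).
Hypothesis S_regular : forall s x : T, S s -> s * x = 0 -> x = 0.
Hypothesis S_noeth : fractions_aleph0_noetherian S.
Variables (A B : choiceType) (u : {linear freemod T A -> freemod T B}).
Hypothesis u_inj : inj0 u.

(** Equivalently, the preimage under [u] of the free module on [D] is free on the basis elements
    that [u] sends into it. *)
Definition closed_set (D : set B) : Prop :=
  forall x, supported D (u x) ->
  forall a, coef a x != 0 -> supported D (u (basis T a)).

(** Up to a denominator [s], any [x] with [u x] supported on the union agrees on the coordinates in
    [C] with a combination [w] of countably many generators. Then [u (s *: x - w)] is supported on
    [D], and closedness applies outside the support of the generators. *)
Lemma closed_set_step (D C : set B) : closed_set D -> countable C ->
  exists W : set A, countable W /\ forall x, supported (D `|` C) (u x) ->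
    forall a, coef a x != 0 -> supported D (u (basis T a)) \/ W a.
Proof.
move=> clD /countable_injP[code code_inj].
pose V := [set x | supported (D `|` C) (u x)].
have VV : is_submodule V.
  have [D0 Dlin] := supported_submodule T (D `|` C).
  by split=> [|a x y Vx Vy]; rewrite /V /= ?linear0 // linearP; apply: Dlin.
have /choice[c cE] : forall n : nat, exists c : {linear freemod T A -> T^o},
    (forall b, C b -> code b = n -> forall x, c x = coef b (u x)) /\
    forall x, c x <> 0 -> exists b, [/\ C b, code b = n & coef b (u x) <> 0].
  move=> n; have [[b [Cb bn]]|nC] := pselect (exists b, C b /\ code b = n).
    exists (coef b \o u); split=> [b' Cb' b'n x|x /= cx]; last by exists b.
    by rewrite (code_inj b b') ?inE // b'n.
  (* No element of [C] has code [n]: take the zero functional. *)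
  exists (coef 0%N \o \0); split=> [b Cb bn|x]; first by case: nC; exists b.
  by rewrite /= linear0.
have [x Vx|W [cW WV Wgen]] := countable_generation_by_coordinates S1 SM S_noeth (c := c) VV.
  exists (\max_(b <- supp (u x)) code b).+1 => m; apply: contraPP => cmx0.
  apply/negP; rewrite -ltnNge ltnS.
  have [_ /(_ x cmx0)[b [_ <- bx]]] := cE m.
  by apply: leq_bigmax_seq => //; rewrite mem_supp; apply/eqP.
exists (\bigcup_(w in W) [set a | coef a w != 0]); split.
  by apply: bigcup_countable => // w _; exact: supported_countable.
move=> x Vx a xa; have [s [w [Ss Ww sxw0]]] := Wgen _ Vx.
pose supW := \bigcup_(w in W) [set a | coef a w != 0].
have w_supW : supported supW w.
  apply: (span_sub (supported_submodule T _)) Ww => w' Ww' a' wa'.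
  by exists w'.
have [|nWa] := pselect (supW a); [by right | left].
apply: (clD (s *: x - w)).
  move=> b ub; have [//|Cb] : (D `|` C) b.
    have : V (s *: x - w).
      by apply: (submoduleB VV); [exact: (submoduleZ s VV Vx) | exact: (span_sub VV WV Ww)].
    exact.
  case: (cE (code b)) => /(_ _ Cb erefl (s *: x - w)) cb _.
  by rewrite -cb sxw0 eqxx in ub.
have wa : coef a w = 0.
  by apply/eqP; apply: contrapT => /negP /w_supW.
(* Since [s] is regular, multiplying by it does not shrink the support of [x]. *)
rewrite linearB /= wa subr0 linearZ /=; apply: contra_neq xa.
exact: S_regular.
Qed.

(** Starting from [b0], alternate the previous lemma with adding the supports of the new images; the
    union of the countably many stages is closed, because a finite support lies in one stage. *)
Lemma closed_set_extend (D : set B) (b0 : B) : closed_set D ->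
  exists C : set B, [/\ countable C, C b0, closed_set (D `|` C) &
    countable [set a | supported (D `|` C) (u (basis T a)) /\
                       ~ supported D (u (basis T a))]].
Proof.
move=> clD.
have /choice[W WP] : forall C : set B, exists W : set A, countable C ->
    countable W /\ forall x, supported (D `|` C) (u x) ->
    forall a, coef a x != 0 -> supported D (u (basis T a)) \/ W a.
  move=> C; have [cC|] := pselect (countable C); last by exists set0.
  by have [W] := closed_set_step clD cC; exists W.
pose next C := C `|` \bigcup_(a in W C) [set b | coef b (u (basis T a)) != 0].
pose Cn n := iter n next [set b0].
have cCn n : countable (Cn n).
  elim: n => [|n IHn]; first exact: countable1.
  rewrite /= /next -bigcup2E; apply: bigcup_countable => // -[|[|i]] _ //=.
  - by apply: bigcup_countable => [|a _]; [case: (WP _ IHn) | exact: supported_countable].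
have Cn_mono m n : (m <= n)%N -> Cn m `<=` Cn n.
  elim: n => [|n IHn]; first by rewrite leqn0 => /eqP ->.
  rewrite leq_eqVlt => /predU1P[-> //|mn].
  exact: subset_trans (IHn mn) (@subsetUl _ _ _).
pose C := \bigcup_n Cn n.
have C_stage y : supported (D `|` C) y -> exists n, supported (D `|` Cn n) y.
  move=> Cy; pose P b n := D b \/ Cn n b.
  have /choice[st stP] : forall b, exists n, coef b y != 0 -> P b n.
    move=> b; have [/eqP y0|yb] := boolP (coef b y == 0); first by exists 0%N => /eqP.
    by case: (Cy b yb) => [Db|[n _ Cb]]; [exists 0%N; left | exists n; right].
  exists (\max_(b <- supp y) st b) => b yb; have [Db|Cb] := stP b yb; [by left|right].
  by apply: Cn_mono Cb; apply: leq_bigmax_seq => //; rewrite mem_supp.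
have C_W n x : supported (D `|` Cn n) (u x) -> forall a, coef a x != 0 ->
    supported (D `|` Cn n.+1) (u (basis T a)) /\
    (supported D (u (basis T a)) \/ W (Cn n) a).
  move=> ux a xa; have [_ /(_ x ux a xa)[Da|Wa]] := WP _ (cCn n).
    by split; [apply: supported_sub Da; exact: subsetUl | left].
  by split; [move=> b ub; right; right; exists a | right].
exists C; split.
- by apply: bigcup_countable.
- by exists 0%N.
- move=> x /C_stage[n /C_W ux] a xa; have [ua _] := ux a xa.
  by apply: supported_sub ua; apply: setUS => b Cb; exists n.+1.
apply: (@sub_countable _ _ _ (\bigcup_n W (Cn n))).
  apply: subset_card_le => a [/C_stage[n ua] nDa]; exists n => //.
  (* Over the zero ring [a] is not in the support of its own basis vector, but then that vector is
     zero. *)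
  have [a0|a0] := eqVneq (coef a (basis T a)) 0; last by have [_ []] := C_W n _ ua a a0.
  case: nDa; suff -> : basis T a = 0 by rewrite linear0 => b; rewrite linear0 eqxx.
  apply: coef_eq => a'; rewrite linear0; move: a0; rewrite !coef_basis eqxx.
  move=> t0; case: eqP => // _; exact: t0.
by apply: bigcup_countable => // n _; case: (WP _ (cCn n)).
Qed.

Theorem solves_countable_ext_along (X : lmodType T) :
  solves_countable_systems X -> ext_along u X.
Proof.
move=> Xsol f _.
pose dom (G : set (B * X)) := [set b | exists x, G (b, x)].
(* Graphs of partial solutions with closed domain. Since [lift] takes total functions, every total
   extension [g] is asked to solve the equations over the domain. *)
pose P (G : set (B * X)) := [/\ (forall b x y, G (b, x) -> G (b, y) -> x = y),
  closed_set (dom G) &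
  forall g : B -> X, (forall b x, G (b, x) -> g b = x) ->
  forall x, supported (dom G) (u x) -> lift g (u x) = f x].
have chain F : F `<=` P -> total_on F subset -> P (\bigcup_(G in F) G).
  move=> FP totF; set U := \bigcup_(G in F) G.
  (* A finite support falls into one member of the chain. An empty one forces [x = 0] by injectivity
     of [u], which also covers the empty chain. *)
  have domU x : supported (dom U) (u x) -> x = 0 \/
      exists2 G, F G & supported (dom G) (u x).
    move=> Ux; have stage (s : seq B) : {subset s <= supp (u x)} ->
        s = [::] \/ exists2 G, F G & forall b, b \in s -> dom G b.
      elim: s => [|b s IHs] bs; [by left | right].
      have [z [G FG Gz]] : dom U b by apply: Ux; rewrite -mem_supp bs ?mem_head.
      have [|->|[G' FG' G's]] := IHs.
      - by move=> b' b's; apply: bs; rewrite inE b's orbT.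
      - by exists G => // b'; rewrite inE => /eqP ->; exists z.
      have [GG'|G'G] := totF _ _ FG FG'.
        exists G' => // b'; rewrite inE => /predU1P[->|/G's //].
        by exists z; apply: GG'.
      exists G => // b'; rewrite inE => /predU1P[->|/G's[z' G'z']]; first by exists z.
      by exists z'; apply: G'G.
    have [|u0|[G FG Gs]] := stage (supp (u x)) => //.
      left; apply: u_inj; apply: coef_eq => b; rewrite linear0; apply/eqP.
      by rewrite -[_ == _]negbK -mem_supp u0.
    by right; exists G => // b; rewrite -mem_supp; exact: Gs.
  have GU G : F G -> dom G `<=` dom U.
    by move=> FG b [z Gz]; exists z; exists G.
  split.
  - move=> b x y [G FG Gx] [G' FG' G'y].
    have [GG'|G'G] := totF _ _ FG FG'.
      by have [Gfun _ _] := FP _ FG'; apply: (Gfun b) => //; exact: GG'.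
    by have [Gfun _ _] := FP _ FG; apply: (Gfun b) => //; exact: G'G.
  - move=> x /domU[->|[G FG Gx]] a xa; first by rewrite linear0 eqxx in xa.
    have [_ clG _] := FP _ FG.
    by apply: supported_sub (clG _ Gx _ xa); exact: GU.
  - move=> g gU x /domU[->|[G FG Gx]]; first by rewrite !linear0.
    have [_ _ extG] := FP _ FG; apply: extG => // b z Gz.
    by apply: gU; exists G.
have [G [[Gfun clG extG] maxG]] := Zorn_bigcup chain.
set D := dom G in clG.
have /choice[g0 g0P] : forall b, exists x, if `[< D b >] then G (b, x) else x = 0.
  move=> b; case: asboolP => [[x Gx]|_]; first by exists x.
  by exists 0.
have g0G b x : G (b, x) -> g0 b = x.
  move=> Gx; have Db : D b by exists x.
  by have := g0P b; rewrite (asboolT Db) => /Gfun; apply.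
have g00 b : ~ D b -> g0 b = 0.
  by have := g0P b; case: asboolP.
suff DT b : D b.
  by exists (lift g0) => x; rewrite /= extG // => b _; exact: DT.
apply: contrapT => nDb.
have [C [cC Cb clDC cA']] := closed_set_extend b clG.
set A' := [set a | _] in cA'.
(* The unknowns in [C] outside [D] must make up the defect of [g0] on the new equations [A']. *)
have [|x xA' ux0|g1 [g10 g1E]] := solve_countable_subsystem Xsol
    (B' := C `\` D) (u := u) (fun a => f (basis T a) - lift g0 (u (basis T a))) cA'.
- by apply: sub_countable cC; apply: subset_card_le => ? [].
(* Independence: [u x] is supported on [D], so by closedness every index in the support of [x] is an
   old equation, contrary to [A']. *)
- have uxD : supported D (u x).
    have uxDC : supported (D `|` C) (u x).
      by apply: supported_linear => a /xA'[].
    move=> b' ub'; apply: contrapT => nDb'; case: (uxDC _ ub') => // Cb'.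
    by rewrite ux0 ?eqxx in ub'.
  apply: coef_eq => a; rewrite linear0; apply/eqP; apply: contrapT => /negP xa.
  by have [_] := xA' _ xa; apply; exact: clG uxD _ xa.
pose G' : set (B * X) := [set z | (D `|` C) z.1 /\ z.2 = g0 z.1 + g1 z.1].
have domG' : dom G' = D `|` C.
  apply/seteqP; split=> [b' [x []] //|b' DCb'].
  by exists (g0 b' + g1 b').
apply: (maxG G').
  split=> [[b' x] Gx|G'G].
    split; first by left; exists x.
    by rewrite /= (g0G _ _ Gx) g10 ?addr0 // => -[_]; apply; exists x.
  by apply: nDb; exists (g0 b + g1 b); apply: G'G; split=> //; right.
split; rewrite ?domG' //; first by move=> b' x y [_ /= ->] [_ /= ->].
move=> g gG' x uxDC.
have -> : lift g (u x) = lift (fun b => g0 b + g1 b) (u x).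
  by apply: lift_eq_on_supp => b' /uxDC DCb'; apply: gG'.
rewrite lift_add.
apply: (@linear_eq_on_supp _ _ _ ((lift g0 \o u) \+ (lift g1 \o u)) f) => a xa /=.
have uaDC := clDC _ uxDC _ xa.
have [uaD|nuaD] := pselect (supported D (u (basis T a))).
  rewrite extG // lift_eq0 ?addr0 // => b' /uaD Db'.
  by apply: g10 => -[].
by rewrite g1E // addrC subrK.
Qed.

End Deconstruction.

(** * Adjoining solutions of all countable systems *)

(* A countable system of equations over the module generated by [K] and the    *)
(* formal solutions of the systems constructed before: [Node c k l t ch ix]    *)
(* has coefficient matrix [c], and its [i]-th right-hand side is [k i] plus    *)
(* the combination, with coefficients [t i m] for [m < l i], of the [ix i m]-th *)
(* components of the formal solutions of the systems [ch i m].                 *)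
Inductive node (T : pzRingType) (K : Type) :=
  Node (c : {c : nat -> freemod T (nat + nat)%type | forall z, lift c z = 0 -> z = 0})
       (k : nat -> K) (l : nat -> nat) (t : forall i, 'I_(l i) -> T)
       (ch : forall i, 'I_(l i) -> node T K) (ix : forall i, 'I_(l i) -> nat + nat).

HB.instance Definition _ T K := gen_eqMixin (node T K).
HB.instance Definition _ T K := gen_choiceMixin (node T K).

Section Solutions.
Variables (T : pzRingType) (K : lmodType T).
Local Notation node := (node T K).
Local Notation var := (node * (nat + nat))%type.

Fixpoint below (n' n : node) : Prop :=
  let: Node _ _ _ _ ch _ := n in
  exists a m, n' = ch a m \/ below n' (ch a m).

Lemma below_trans x y z : below x y -> below y z -> below x z.
Proof.
move=> xy; elim: z => c k l t ch IHch ix /= [a [m [yE|yz]]]; exists a, m; right.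
  by rewrite -yE.
exact: IHch.
Qed.

Lemma below_irrefl n : ~ below n n.
Proof.
elim: n => c k l t ch IHch ix nn; have /= [a [m nch]] := nn.
apply: (IHch a m); case: nch => [<- //|n_ch].
by apply: below_trans n_ch; exists a, m; left.
Qed.

(** A node below no member of the list occurs in none of their right-hand sides, which isolates its
    own equations. *)
Lemma maximal_node (s : seq node) : s <> [::] ->
  exists2 n, n \in s & forall n', n' \in s -> ~ below n n'.
Proof.
elim: s => // n [|n1 s] IHs _.
  by exists n; rewrite ?mem_head // => n'; rewrite inE => /eqP ->; exact: below_irrefl.
have [m ms mmax] := IHs (fun e => ltac:(by [])).
have [mn|mn] := pselect (below m n).
  exists n; rewrite ?mem_head // => n'; rewrite inE => /predU1P[->|n's nn'].
    exact: below_irrefl.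
  by apply: (mmax _ n's); exact: below_trans nn'.
exists m; first by rewrite inE ms orbT.
by move=> n'; rewrite inE => /predU1P[->|/mmax].
Qed.

Definition node_matrix (n : node) : nat -> freemod T (nat + nat)%type :=
  let: Node c _ _ _ _ _ := n in sval c.

Lemma node_matrix_inj n z : lift (node_matrix n) z = 0 -> z = 0.
Proof. by case: n => -[c c_inj] k l t ch ix; exact: c_inj. Qed.

Definition node_const (n : node) (i : nat) : K :=
  let: Node _ k _ _ _ _ := n in k i.

Definition node_rhs (n : node) (i : nat) : freemod T var :=
  let: Node _ _ l t ch ix := n in
  \sum_(m < l i) t i m *: basis T (ch i m, ix i m).

Definition node_lhs (n : node) (i : nat) : freemod T var :=
  lift (fun b => basis T (n, b)) (node_matrix n i).

Definition node_equation (ni : node * nat) : freemod T var :=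
  node_lhs ni.1 ni.2 - node_rhs ni.1 ni.2.

Lemma coef_node_rhs n n' i b : ~ below n n' -> coef (n, b) (node_rhs n' i) = 0.
Proof.
case: n' => c k l t ch ix /= nch; rewrite linear_sum big1 // => m _.
rewrite linearZ /= coef_basis; case: eqP => [[nE _]|]; last by rewrite scaler0.
by case: nch; exists i, m; left.
Qed.

Lemma coef_node_lhs n n' i b :
  coef (n, b) (node_lhs n' i) = if n' == n then coef b (node_matrix n i) else 0.
Proof.
have [->|n'n] := eqVneq n' n.
  apply: (@lift_ext _ _ _ (coef (n, b) \o lift (fun b => basis T (n, b))) (coef b)) => b' /=.
  by rewrite lift_basis !coef_basis xpair_eqE eqxx.
apply: (@lift_ext _ _ _ (coef (n, b) \o lift (fun b => basis T (n', b))) \0) => b' /=.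
by rewrite lift_basis coef_basis xpair_eqE (negPf n'n).
Qed.

(* At a maximal node of the support, the only contributions to the variables  *)
(* of that node come from its own left-hand sides.                            *)
Lemma node_equation_inj z : lift node_equation z = 0 -> z = 0.
Proof.
move=> z0; apply: contrapT => nz.
have [|n ns nmax] := @maximal_node (map fst (supp z)).
  move=> s0; apply: nz; apply: coef_eq => i; rewrite linear0; apply/eqP.
  rewrite -[_ == _]negbK -mem_supp; apply/negP => /(map_f fst).
  by rewrite s0.
have [pr prE] := lift_exists (fun mi : node * nat => if mi.1 == n then basis T mi.2 else 0).
have pr0 : pr z = 0.
  apply: (@node_matrix_inj n); apply: coef_eq => b.
  rewrite linear0 -(_ : coef (n, b) (lift node_equation z) = 0); last by rewrite z0 linear0.
  symmetry; apply: (@linear_eq_on_supp _ _ _ (coef (n, b) \o lift node_equation)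
    (coef b \o lift (node_matrix n) \o pr)) => -[n' i] zi /=.
  rewrite lift_basis prE linearB /= coef_node_lhs coef_node_rhs ?subr0; last first.
    by apply: nmax; rewrite -mem_supp in zi; exact: (map_f fst zi).
  by have [_|_] := eqVneq n' n; rewrite ?lift_basis // !linear0.
have {ns}/mapP[[n' i] zi /= nE] := ns; move: zi; rewrite -nE mem_supp.
suff -> : coef (n, i) z = coef i (pr z) by rewrite pr0 linear0 eqxx.
apply: (@lift_ext _ _ _ (coef (n, i)) (coef i \o pr)) => -[m j] /=.
rewrite prE coef_basis xpair_eqE; case: eqVneq => _ /=; last by rewrite linear0.
by rewrite coef_basis.
Qed.

(** Dividing by it imposes that the left-hand side equals the constant plus the right-hand side. *)
Definition solution_relation (ni : node * nat) : (K * freemod T var)%type :=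
  (- node_const ni.1 ni.2, node_equation ni).

Let relations : {linear freemod T (node * nat)%type -> (K * freemod T var)%type} :=
  lift solution_relation.

Lemma relations_snd z : (relations z).2 = lift node_equation z.
Proof.
apply: (@lift_ext _ _ _ (snd \o relations) (lift node_equation)) => i /=.
by rewrite !lift_basis.
Qed.

Lemma relations_inj : inj0 relations.
Proof.
by move=> z z0; apply: node_equation_inj; rewrite -relations_snd z0.
Qed.

Definition solution_module : lmodType T := quotmod (range_submodule relations).

(** Each [f i] lifts to an element of [K] plus a finite combination of earlier formal solutions.
    This is the data of a new node [n], whose own variables solve the system. *)
Lemma solution_module_solves : solves_countable_systems solution_module.
Proof.
move=> c c_inj f.
pose pi : {linear (K * freemod T var)%type -> solution_module} :=
  quotmod_proj (range_submodule relations).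
have /choice[fr frE] : forall i, exists x, pi x = f i by move=> i; exact: quotmod_proj_surj.
pose y i := (fr i).2.
pose n : node := Node (exist _ c c_inj) (fun i => (fr i).1)
  (fun i m => coef (tnth (in_tuple (supp (y i))) m) (y i) : T)
  (fun i m => (tnth (in_tuple (supp (y i))) m).1)
  (fun i m => (tnth (in_tuple (supp (y i))) m).2).
have rhsE i : node_rhs n i = y i.
  rewrite [RHS]free_sum big_tnth; apply: eq_bigr => m _.
  by rewrite -surjective_pairing.
have inr_lin : linear (fun z : freemod T var => (0 : K, z)).
  by move=> a x z; congr pair; rewrite /= scaler0 addr0.
exists (fun b => pi (0, basis T (n, b))) => i.
have -> : lift (fun b => pi (0, basis T (n, b))) (c i) = pi (0, node_lhs n i).
  apply: (@lift_ext _ _ _ (lift _)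
    (pi \o lin inr_lin \o lift (fun b => basis T (n, b)))) => b /=.
  by rewrite !lift_basis.
rewrite -frE; apply/quotmod_proj_eq; exists (basis T (n, i)) => //.
rewrite /= lift_basis /solution_relation /node_equation rhsE.
by congr pair; rewrite /= sub0r.
Qed.

End Solutions.

(** * The cotorsion pair *)

Section Main.
Variable T : pzRingType.
Implicit Types M X : lmodType T.

Lemma free_countably_generated (I : countType) :
  countably_generated [set: freemod T I].
Proof.
exists (range (@basis T I)); first exact: sub_countable (card_image_le _ _) (countableP _).
apply/seteqP; split=> // x _; rewrite [x]free_sum.
apply: big_ind => [|y z|i _].
- exact: (proj1 (span_submodule _)).
- exact: submoduleD (span_submodule _).
- by apply: (submoduleZ _ (span_submodule _)); apply: sub_span; exists i.
Qed.

(** The cokernel of [lift c] is a test module: since [lift c] is injective, it has a resolution of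
    length 1 by free modules of countable rank. *)
Lemma perp_solves_countable_systems X :
  right_perp (fun M => mod_aleph0 M /\ pdim_le 1 M) X -> solves_countable_systems X.
Proof.
move=> perpX c c_inj f.
pose u : {linear freemod T nat -> freemod T (nat + nat)%type} := lift c.
pose M : lmodType T := quotmod (range_submodule u).
pose p : {linear freemod T (nat + nat)%type -> M} := quotmod_proj (range_submodule u).
have up : short_presentation u p.
  split; [exact: projective_free | exact: quotmod_proj_surj |].
  move=> x; rewrite quotmod_proj_eq0; split=> [[y _ <-]|[y <-]]; first by exists y.
  by exists y.
have projT : projective (freemod T nat) by exact: projective_free.
have [R [R0 R1 R2]] := short_resolution up projT c_inj.
have pdM : pdim_le 1 M by exists R.
have ctM : mod_aleph0 M.
  exists R => -[|[|k]].
  - by rewrite R0; exact: free_countably_generated.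
  - by rewrite R1; exact: free_countably_generated.
  exists set0 => //; apply/seteqP; split=> // x _; rewrite (R2 _ _ x) //.
  exact: (proj1 (span_submodule _)).
have /(Ext1_ext_along _ up)/(_ (lift f)) := perpX M (conj ctM pdM) 1%N isT.
case=> [y /c_inj ->|g gE]; first exact: linear0.
exists (fun b => g (basis T b)) => n.
have -> : lift (fun b => g (basis T b)) (c n) = g (c n).
  by apply: (@lift_ext _ _ _ (lift _) g) => b /=; rewrite lift_basis.
by have := gE (basis T n); rewrite /= !lift_basis.
Qed.

Variable S : set T.
Hypotheses (S1 : S 1) (SM : forall s t, S s -> S t -> S (s * t)).
Hypothesis S_regular : forall s x : T, S s -> s * x = 0 -> x = 0.
Hypothesis S_noeth : fractions_aleph0_noetherian S.

Lemma solves_countable_systems_perp X :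
  solves_countable_systems X -> right_perp (pdim_le 1) X.
Proof.
move=> Xsol M pdM [|[|i]] // _; last exact: pdim1_Ext_high.
have [I [J [u [p [up u_inj]]]]] := free_presentation pdM.
apply/(Ext1_ext_along _ up).
exact: (solves_countable_ext_along S1 SM S_regular S_noeth u_inj Xsol).
Qed.

Lemma left_perp_pdim1 M :
  left_perp (right_perp (pdim_le 1)) M -> pdim_le 1 M.
Proof.
move=> perpM; pose p : {linear freemod T M -> M} := lift (idfun : M -> M).
have surjp : surj p by move=> m; exists (basis T m); rewrite /= lift_basis.
pose K : lmodType T := submod (kernel_submodule p).
pose a : {linear K -> freemod T M} := val.
have inja : inj0 a by move=> x ax0; apply: val_inj; rewrite linear0.
have exa : exact a p.
  move=> x; split=> [px|[y <-]]; last exact: (@submodP _ _ _ (kernel_submodule p)).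
  by exists (Submod (kernel_submodule p) px).
have ap : short_presentation a p by split=> //; exact: projective_free.
pose X := solution_module K.
pose V := freemod T (node T K * (nat + nat))%type.
pose rel : {linear freemod T (node T K * nat)%type -> (K * V)%type} :=
  lift (@solution_relation T K).
pose pi : {linear (K * V)%type -> X} := quotmod_proj (range_submodule rel).
have inl_lin : linear (fun k : K => (k, 0 : V)).
  by move=> t x y; congr pair; rewrite /= scaler0 addr0.
have Xperp := solves_countable_systems_perp (@solution_module_solves T K).
have /(Ext1_ext_along _ ap)/(_ (pi \o lin inl_lin)) := perpM _ Xperp 1%N isT.
case=> [y /inja ->|g gE]; first exact: linear0.
have [|gh ghE] := projective_lift (u := g) (a := pi) (projective_free (T := T) (I := M)).
  by move=> c; exact: quotmod_proj_surj.
(* [(k, 0)] and [gh (a k)] agree in [X], so their difference lies in the range of [rel] and, [rel]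
   being injective, comes from a linear map [th] into a free module. *)
have th_lin : linear (fun k : K => (k, 0 : V) - gh (a k)).
  move=> t x y; rewrite (inl_lin t x y) !(linearP a, linearP gh).
  by rewrite opprD scalerBr addrACA.
have projI : projective (freemod T (node T K * nat)%type) by exact: projective_free.
have rel_th k : exists y, rel y = (k, 0) - gh (a k).
  have /quotmod_proj_eq0[y _ yE] : pi ((k, 0) - gh (a k)) = 0.
    by rewrite linearB /= ghE -gE subrr.
  by exists y.
have [th thE] := factor_through_image (u := lin th_lin) (a := rel) (f := idfun)
  rel_th (@relations_inj T K).
apply/pdim1P; exists K, (freemod T M), a, p; split=> //.
(* First components of [rel (th k) = (k, 0) - gh (a k)] recover [k] from [th k] and [a k], so [K] is
   a retract of a product of free modules. *)
have i_lin : linear (fun k => (th k, a k)) by move=> t x y; rewrite !linearP.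
have r_lin : linear (fun z : freemod T (node T K * nat)%type * freemod T M =>
    (rel z.1).1 + (gh z.2).1).
  by move=> t x y; rewrite /= !linearP /= scalerDr addrACA.
apply: (@projective_retract _ _ _ (lin i_lin) (lin r_lin)).
  move=> k /=; have [y yE] := rel_th k.
  by rewrite (thE k y yE) yE /= subrK.
by apply: projective_pair => //; exact: projective_free.
Qed.

Theorem pdim1_of_countable_type :
  @of_countable_type T (pdim_le 1) (right_perp (pdim_le 1)).
Proof.
split.
  split=> M; split=> // [pdM X /(_ _ pdM) //|]; exact: left_perp_pdim1.
exists (fun M => mod_aleph0 M /\ pdim_le 1 M); split=> [M []//|X]; split.
  by move=> /perp_solves_countable_systems/solves_countable_systems_perp.
by move=> perpX M [_ pdM]; exact: perpX.
Qed.
End Main.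

Theorem proposition5p5 (R : pzRingType) (S : set R)
  (S_regular : S `<=` @non_zero_divisors R)
  (S_multiplicative : multiplicative_subset S)
  (S_Ore : right_Ore S)
  (Q : pzRingType) (phi : {rmorphism R -> Q})
  (Q_fractions : is_right_ring_of_fractions S phi)
  (Q_noetherian : right_aleph0_noetherian Q) :
  @of_countable_type R^c (pdim_le 1) (right_perp (pdim_le 1)).
Proof.
have [S1 SM] := S_multiplicative.
apply: (@pdim1_of_countable_type R^c S S1).
- by move=> s t Ss St; exact: SM.
(* In [R^c] the product [s * x] is [x * s] of [R], so right regularity is the half required. *)
- move=> s x Ss sx0; have [_] := S_regular _ Ss; apply.
  by rewrite mul0r.
- exact: (fractions_noetherian S_regular S_multiplicative S_Ore Q_fractions).
Qed.
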